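(* Let $\mathbf P=(P,\le,0,1)$ be a bounded poset satisfying the Ascending Chain Condition as well as the Descending Chain Condition, let $\mathbf Q=(Q,\le,0)$ be a poset with least element $0$, let $f$ be an up-homomorphism from $\mathbf P$ to $\mathbf Q$, let $f^*\colon Q\to\mathbb A(\mathbf P)$ denote the operator for which $(f,f^* )$ is a pair of operator-residuated mappings between $\mathbf P$ and $\mathbf Q$, and let $a,b\in P$. Then $f(a)=f(b)$ (i.e. $(a,b)\in\ker f$) if and only if \[ \operatorname{Min}U\Big(f^*\big(f(a)\big),f^*(0)\Big)=\operatorname{Min}U\Big(f^*\big(f(b)\big),f^*(0)\Big). \]
   Context: For a poset $(P,\le)$ and $A,B\subseteq P$: $U(A)$ is the set of all upper bounds of $A$ in $P$, $U(A,B):=U(A\cup B)$, $U(x,y):=U(\{x,y\})$, and $\operatorname{Min}A$ is the set of all minimal elements of $A$. A mapping $f\colon P\to Q$ between posets is an up-homomorphism if $f\big(\operatorname{Min}U(x,y)\big)=\operatorname{Min}U\big(f(x),f(y)\big)$ (equality of subsets of $Q$, the left side being the image of a set under $f$) for all $x,y\in P$. The Ascending (Descending) Chain Condition means that there are no infinite strictly ascending (descending) chains. A bounded poset is one with least element $0$ and greatest element $1$. $\mathbb A(\mathbf P)$ is the set of all non-empty antichains of $\mathbf P$. A pair of operator-residuated mappings between $\mathbf P$ and $\mathbf Q$ is a pair $(f,f^* )$ with $f\colon P\to Q$ and $f^*\colon Q\to\mathbb A(\mathbf P)$ such that for all $x\in P$, $y\in Q$: $f(x)\le y$ if and only if there is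 some $z\in f^*(y)$ with $x\le z$. Such an $f^*$ is uniquely determined by $f$. $\ker f=\{(x,y)\in P^2\mid f(x)=f(y)\}$. *)

(* Defs.v *)
From mathcomp Require Import all_boot all_order.
From mathcomp Require Import classical_sets.

Set Implicit Arguments.
Unset Strict Implicit.
Unset Printing Implicit Defensive.

Local Open Scope classical_set_scope.
Local Open Scope order_scope.

(* U(A) is [ubound A], U(A, B) is [ubound (A `|` B)] and U(x, y) is
   [ubound [set x; y]]. *)

Definition minimals (d : Order.disp_t) (P : porderType d) (A : set P) : set P :=
  [set x | A x /\ forall y, A y -> ~~ (y < x)].

Definition ascending_chain_condition (d : Order.disp_t) (P : porderType d) :=
  ~ exists u : nat -> P, forall n, u n < u n.+1.

Definition descending_chain_condition (d : Order.disp_t) (P : porderType d) :=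
  ~ exists u : nat -> P, forall n, u n.+1 < u n.

Definition antichain (d : Order.disp_t) (P : porderType d) (A : set P) :=
  forall x y, A x -> A y -> x <> y -> x >< y.

Definition nonempty_antichains (d : Order.disp_t) (P : porderType d) :
    set (set P) :=
  [set A | A !=set0 /\ antichain A].
Arguments nonempty_antichains {d} P.

Definition up_homomorphism (d d' : Order.disp_t) (P : porderType d)
    (Q : porderType d') (f : P -> Q) :=
  forall x y : P,
    f @` minimals (ubound [set x; y]) = minimals (ubound [set f x; f y]).

Definition operator_residuated (d d' : Order.disp_t) (P : porderType d)
    (Q : porderType d') (f : P -> Q) (fs : Q -> set P) :=
  (forall y, nonempty_antichains P (fs y)) /\
  (forall x y, f x <= y <-> exists2 z, fs y z & x <= z).

(* Main.v *)
(** For any value [f a] the antichain [f^*(f a)] is a singleton: if [z] is one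
    of its elements above [a] and [t] is another one, then
    [Min U (f z, f t) = {f a}], so the up-homomorphism property yields an upper
    bound [w] of [z] and [t] with [f w = f a], and [w] lies below an element of
    [f^*(f a)], which the antichain condition forces to be equal to both [z]
    and [t].  As [f^*(0)] is non-empty, [0] is itself a value of [f], and
    [f^*(0)] is a singleton lying below [f^*(f a)].  Hence
    [Min U (f^*(f a), f^*(0)) = f^*(f a)], from which [f a] is recovered
    because [f z = f a]. *)

Require Import Defs.
From mathcomp Require Import all_boot all_order.
From mathcomp Require Import classical_sets.

Set Implicit Arguments.
Unset Strict Implicit.
Unset Printing Implicit Defensive.

Import Order.Theory.

Local Open Scope classical_set_scope.
Local Open Scope order_scope.

(** A greatest element of [A] is the least element of [ubound A], hence its only minimal one. *)
Lemma minimals_ubound_greatest (d : Order.disp_t) (P : porderType d)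
    (A : set P) (z : P) :
  A z -> ubound A z -> minimals (ubound A) = [set z].
Proof.
move=> Az ubz; apply/seteqP; split=> [x [ubx minx]|_ ->] /=.
  by have := minx z ubz; have := ubx z Az; rewrite le_eqVlt => /orP[/eqP->|->].
split=> // y uby; apply/negP => /lt_geF.
by rewrite (uby z Az).
Qed.

Lemma antichain_le_eq (d : Order.disp_t) (P : porderType d) (A : set P) x y :
  antichain A -> A x -> A y -> x <= y -> x = y.
Proof.
move=> antiA Ax Ay xy; case: (eqVneq x y) => // /eqP/(antiA x y Ax Ay).
by rewrite /Order.comparable xy.
Qed.

Section OperatorResiduated.
Variables (d d' : Order.disp_t) (P : porderType d) (Q : porderType d').
Variables (f : P -> Q) (fs : Q -> set P).
Hypothesis ffs : operator_residuated f fs.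

Lemma operator_residuated_homo : {homo f : x y / x <= y}.
Proof.
move=> x y xy; apply/(ffs.2 x (f y)).
by have /(ffs.2 y (f y))[z fsz yz] := lexx (f y); exists z => //; apply: le_trans yz.
Qed.

Lemma operator_residuated_apply_le y z : fs y z -> f z <= y.
Proof. by move=> fsz; apply/(ffs.2 z y); exists z. Qed.

Lemma residual_image_singleton (f_up : up_homomorphism f) a :
  exists2 z, fs (f a) = [set z] & f z = f a.
Proof.
have [_ antifs] := ffs.1 (f a).
have /(ffs.2 a (f a))[z fsz az] := lexx (f a).
(* One inequality comes from [fs (f a) z], the other from [a <= z] by monotonicity. *)
have fz : f z = f a.
  apply/le_anti.
  by rewrite operator_residuated_apply_le //= operator_residuated_homo.
exists z => //; apply/seteqP; split=> [t fst|_ ->] //=.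
have ft : f t <= f z by rewrite fz; apply: operator_residuated_apply_le.
have : (f @` minimals (ubound [set z; t])) (f z).
  rewrite f_up (@minimals_ubound_greatest _ _ _ (f z)) //; first by left.
  by move=> _ [->|->].
case=> w [ubw _] fw.
have /(ffs.2 w (f a))[v fsv wv] : f w <= f a by rewrite fw fz.
have zv : z <= v by apply: le_trans wv; apply: ubw; left.
have tv : t <= v by apply: le_trans wv; apply: ubw; right.
by rewrite (antichain_le_eq antifs fsz fsv zv) (antichain_le_eq antifs fst fsv tv).
Qed.

End OperatorResiduated.

Lemma minimals_ubound_residual (d d' : Order.disp_t) (P : porderType d)
    (Q : bPOrderType d') (f : P -> Q) (fs : Q -> set P) (a : P) :
  up_homomorphism f -> operator_residuated f fs ->
  exists2 z, minimals (ubound (fs (f a) `|` fs (\bot : Q))) = [set z]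
           & f z = f a.
Proof.
move=> f_up ffs.
have [z fsa fz] := residual_image_singleton ffs f_up a.
exists z => //.
(* The singleton lemma concerns values of [f] only; [c] exhibits [\bot] as one. *)
have [[c fs0c] _] := ffs.1 \bot.
have fc : f c = \bot.
  by apply/eqP; rewrite -lex0; apply: (operator_residuated_apply_le ffs).
have [z0 fs0 fz0] := residual_image_singleton ffs f_up c.
rewrite fc in fs0 fz0.
(* By residuation [z0] lies below some [v] in [fs (f a)], and [v] can only be [z]; so [z] is
   greatest in the union. *)
have /(ffs.2 z0 (f a))[v] : f z0 <= f a by rewrite fz0 le0x.
rewrite fsa => -> z0z.
rewrite fs0; apply: minimals_ubound_greatest; first by left.
by move=> _ [->|->].
Qed.

Theorem theorem4p4 (d d' : Order.disp_t) (P : tbPOrderType d)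
    (Q : bPOrderType d')
    (accP : ascending_chain_condition P)
    (dccP : descending_chain_condition P)
    (f : P -> Q) (f_up : up_homomorphism f)
    (fs : Q -> set P) (ffs : operator_residuated f fs)
    (a b : P) :
  f a = f b <->
  minimals (ubound (fs (f a) `|` fs (\bot : Q))) =
  minimals (ubound (fs (f b) `|` fs (\bot : Q))).
Proof.
split=> [->//|].
(* With [f a] and [f b] replaced by [f za] and [f zb], it remains to compare two singletons. *)
have [za -> <-] := minimals_ubound_residual a f_up ffs.
have [zb -> <-] := minimals_ubound_residual b f_up ffs.
by move=> /seteqP[/(_ za erefl) /= ->].
Qed.
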